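(* Let $P_0,P_1,P_2$ be noncollinear points in $\mathbb{P}^N$, let $m_0,m_1,m_2$ be non-negative integers with $m_2\ge\max(m_0,m_1)$, and consider the fat point scheme $Z=m_0P_0+m_1P_1+m_2P_2$. Then $\mathrm{sdefect}(I(Z),m)=0$ for all $m\in\mathbb{N}$ if and only if one of the following conditions holds: (a) $m_0+m_1\le m_2$; (b) $m_0+m_1>m_2$ and $m_0+m_1+m_2$ is even.
   Context: $\mathbb{K}$ is an algebraically closed field of any characteristic, $N\ge 2$, and $R=\mathbb{K}[x_0,\ldots,x_N]$ is the homogeneous coordinate ring of $\mathbb{P}^N$. For a point $P$, $I(P)\subseteq R$ is the ideal generated by all forms vanishing at $P$. For distinct points $P_i$ and non-negative integers $m_i$, the fat point scheme $Z=\sum_i m_iP_i$ has ideal $I(Z)=\bigcap_i I(P_i)^{m_i}$ (with $I(P)^0=R$). The $m$-th symbolic power of $I(Z)$ is $I(Z)^{(m)}=\bigcap_i I(P_i)^{mm_i}$. The $m$-symbolic defect $\mathrm{sdefect}(I,m)$ is the minimal number of generators of the $R$-module $I^{(m)}/I^m$; so $\mathrm{sdefect}(I,m)=0$ means $I^{(m)}=I^m$. *)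

(* Defs.v *)
From HB Require Import structures.
From mathcomp Require Import all_boot all_order all_algebra.
From mathcomp Require Import mpoly.

Set Implicit Arguments.
Unset Strict Implicit.
Unset Printing Implicit Defensive.

Import GRing.Theory.
Local Open Scope ring_scope.

(* Ideals are Prop-valued predicates: the boolean ideals of ring_quotient would
   require membership in a generated ideal to be decided. *)
Section Ideals.
Variable R : comNzRingType.
Implicit Types (S I J : R -> Prop) (f g : R) (n k : nat).

Definition ideal_gen S : R -> Prop := fun f =>
  exists2 s : seq (R * R),
    forall z, z \in s -> S z.2 & f = \sum_(z <- s) z.1 * z.2.

Definition ideal_top : R -> Prop := fun _ => True.

Definition ideal_cap I J : R -> Prop := fun f => I f /\ J f.

Definition ideal_mul I J : R -> Prop :=
  ideal_gen (fun f => exists g h, [/\ I g, J h & f = g * h]).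

Definition ideal_exp I n : R -> Prop := iter n (ideal_mul I) ideal_top.

(* The R-module J / I (for I included in J) is generated by k elements,
   namely the classes of the e i. *)
Definition quot_generated J I k : Prop :=
  exists e : 'I_k -> R, (forall i, J (e i)) /\
    forall f, J f -> exists c : 'I_k -> R, I (f - \sum_(i < k) c i * e i).

Definition quot_min_ngen J I k : Prop :=
  quot_generated J I k /\ forall k', quot_generated J I k' -> (k <= k')%N.

End Ideals.

Section FatPoints.
Variables (K : closedFieldType) (N : nat).

(* A point of P^N is a one-dimensional subspace of K^(N+1). *)
Record ppoint := PPoint {
  ppoint_space :> {vspace 'rV[K]_N.+1};
  ppoint_dim : \dim ppoint_space = 1%N
}.

(* A line of P^N is a two-dimensional subspace of K^(N+1). *)
Definition collinear (P0 P1 P2 : ppoint) : Prop :=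
  exists L : {vspace 'rV[K]_N.+1},
    \dim L = 2%N /\ [/\ (P0 <= L)%VS, (P1 <= L)%VS & (P2 <= L)%VS].

Definition vanishes_at (P : ppoint) (f : {mpoly K[N.+1]}) : Prop :=
  forall v : 'rV[K]_N.+1, v \in ppoint_space P -> f.@[v 0] = 0.

Definition point_ideal (P : ppoint) : {mpoly K[N.+1]} -> Prop :=
  ideal_gen (fun f => (exists d : nat, f \is d.-homog) /\ vanishes_at P f).

(* The list [:: (P_1, m_1); ...; (P_r, m_r)] stands for the scheme
   m_1 P_1 + ... + m_r P_r; the P_i are meant to be distinct. *)
Definition fat_points := seq (ppoint * nat).

Definition fat_ideal (Z : fat_points) : {mpoly K[N.+1]} -> Prop :=
  \big[@ideal_cap _/@ideal_top _]_(z <- Z) ideal_exp (point_ideal z.1) z.2.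

Definition symbolic_power (Z : fat_points) (m : nat) : {mpoly K[N.+1]} -> Prop :=
  \big[@ideal_cap _/@ideal_top _]_(z <- Z)
    ideal_exp (point_ideal z.1) (m * z.2)%N.

(* sdefect_is Z m k : the m-th symbolic defect of fat_ideal Z is k.  Being a
   relation, it needs no default value nor a proof that the polynomial ring is
   Noetherian; at most one k satisfies it. *)
Definition sdefect_is (Z : fat_points) (m k : nat) : Prop :=
  quot_min_ngen (symbolic_power Z m) (ideal_exp (fat_ideal Z) m) k.

End FatPoints.

(* Main.v *)
Require Import Defs.
From mathcomp Require Import all_boot all_order all_algebra.
From mathcomp Require Import mpoly zify.

Set Implicit Arguments.
Unset Strict Implicit.
Unset Printing Implicit Defensive.

Import GRing.Theory.

(* Vectors spanning P_0, P_1, P_2 extend to a basis, so a linear change of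
   variables moves them to coordinate points; then I(P_i)^k consists of the
   polynomials all of whose monomials have degree at least k in the variables
   other than x_i.  Symbolic powers and powers of I(Z) are thus monomial, and
   the defect vanishes iff each monomial of I(Z)^(m) is divisible by a product
   of m monomials of I(Z).  Such a splitting is found by lowering exponents and
   trading the variables other than x_0, x_1, x_2 for these.
   If m_0 + m_1 > m_2 and s = m_0 + m_1 + m_2 is odd, the monomial with exponents
   m_1 + m_2 - m_0, m_0 + m_2 - m_1, m_0 + m_1 - m_2 has degree s and lies in
   I(Z)^(2), but the elements of I(Z) have weight at least (s + 1) / 2, with the
   remaining variables counted twice, so those of I(Z)^2 have weight > s. *)

(** * Splitting exponent vectors into m factors *)

(* The monomials of I(Z), in coordinates where P_0, P_1, P_2 are coordinate
   points: a_i is the exponent of x_i and b the total degree in the variables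
   other than x_0, x_1, x_2. *)
Definition fat_cond (m0 m1 m2 a0 a1 a2 b : nat) : Prop :=
  [/\ m0 <= a1 + a2 + b, m1 <= a0 + a2 + b & m2 <= a0 + a1 + b].

(* The monomials of I(Z)^m: those divisible by a product of m monomials of
   I(Z). *)
Fixpoint splits (m0 m1 m2 m a0 a1 a2 b : nat) : Prop :=
  if m is m'.+1 then
    exists u0 u1 u2 c, [/\ fat_cond m0 m1 m2 u0 u1 u2 c,
      [/\ u0 <= a0, u1 <= a1, u2 <= a2 & c <= b]
      & splits m0 m1 m2 m' (a0 - u0) (a1 - u1) (a2 - u2) (b - c)]
  else True.

Lemma splits_swap01 m0 m1 m2 m a0 a1 a2 b :
  splits m0 m1 m2 m a0 a1 a2 b -> splits m1 m0 m2 m a1 a0 a2 b.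
Proof.
elim: m a0 a1 a2 b => //= m IHm a0 a1 a2 b.
case=> [u0 [u1 [u2 [c [[C0 C1 C2] [? ? ? ?] ?]]]]].
exists u1, u0, u2, c; split; [split; lia | by split | exact: IHm].
Qed.

Lemma splits_swap12 m0 m1 m2 m a0 a1 a2 b :
  splits m0 m1 m2 m a0 a1 a2 b -> splits m0 m2 m1 m a0 a2 a1 b.
Proof.
elim: m a0 a1 a2 b => //= m IHm a0 a1 a2 b.
case=> [u0 [u1 [u2 [c [[C0 C1 C2] [? ? ? ?] ?]]]]].
exists u0, u2, u1, c; split; [split; lia | by split | exact: IHm].
Qed.

Lemma splits_mono m0 m1 m2 m a0 a1 a2 b a0' a1' a2' b' :
  a0 <= a0' -> a1 <= a1' -> a2 <= a2' -> b <= b' ->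
  splits m0 m1 m2 m a0 a1 a2 b -> splits m0 m1 m2 m a0' a1' a2' b'.
Proof.
elim: m a0 a1 a2 b a0' a1' a2' b' => //= m IHm a0 a1 a2 b a0' a1' a2' b' l0 l1 l2 lb.
case=> [u0 [u1 [u2 [c [C [? ? ? ?] H]]]]].
exists u0, u1, u2, c; split => //; first by split; lia.
by apply: IHm H; lia.
Qed.

(* A variable other than x_0, x_1, x_2 counts for all three points, so it may
   replace x_0 in any factor. *)
Lemma splits_replace0 m0 m1 m2 m a0 a1 a2 b :
  splits m0 m1 m2 m a0.+1 a1 a2 b -> splits m0 m1 m2 m a0 a1 a2 b.+1.
Proof.
elim: m a0 a1 a2 b => //= m IHm a0 a1 a2 b.
case=> [u0 [u1 [u2 [c [[C0 C1 C2] [? ? ? ?] H]]]]].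
have [le_u0|lt_u0] := leqP u0 a0.
  exists u0, u1, u2, c; split; [by split | by split; lia |].
  rewrite subSn; last by lia.
  by apply: IHm; rewrite -subSn //; lia.
exists a0, u1, u2, c.+1; split; [by split; lia | by split; lia |].
by apply: splits_mono H; lia.
Qed.

Lemma splits_replace1 m0 m1 m2 m a0 a1 a2 b :
  splits m0 m1 m2 m a0 a1.+1 a2 b -> splits m0 m1 m2 m a0 a1 a2 b.+1.
Proof. by move/splits_swap01/splits_replace0/splits_swap01. Qed.

Lemma splits_replace2 m0 m1 m2 m a0 a1 a2 b :
  splits m0 m1 m2 m a0 a1 a2.+1 b -> splits m0 m1 m2 m a0 a1 a2 b.+1.
Proof. by move/splits_swap12/splits_replace1/splits_swap12. Qed.

Lemma splits_large_edge m0 m1 m2 m a0 a1 :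
  m0 + m1 <= m2 -> m * m2 = a0 + a1 -> m * m0 <= a1 -> m * m1 <= a0 ->
  splits m0 m1 m2 m a0 a1 0 0.
Proof.
move=> le_m; elim: m a0 a1 => //= m IHm a0 a1; rewrite !mulSn => e l0 l1.
have le_mm : m * m0 + m * m1 <= m * m2 by rewrite -mulnDr leq_mul2l le_m orbT.
(* Each factor is x_0^(m_2 - u) x_1^u with m_0 <= u <= m_2 - m_1; u is the largest that leaves
   [m * m0] of [a1] to the remaining factors. *)
pose u1 := minn (m2 - m1) (a1 - m * m0).
exists (m2 - u1), u1, 0, 0; split; [by split; lia | by split; lia |].
by apply: IHm; lia.
Qed.

Lemma splits_large_corner m0 m1 m2 m a0 a1 a2 :
  m0 + m1 <= m2 -> m * m2 = a0 + a1 -> a1 + a2 = m * m0 ->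
  splits m0 m1 m2 m a0 a1 a2 0.
Proof.
move=> le_m; elim: m a0 a1 a2 => //= m IHm a0 a1 a2; rewrite !mulSn => e l0.
have le_mm : m * m0 + m * m1 <= m * m2 by rewrite -mulnDr leq_mul2l le_m orbT.
(* With two conditions tight, [u1] determines the factor; m_0 + m_1 <= m_2 gives the condition at
   P_1 for every u_1 <= m_0. *)
pose u1 := minn m0 a1.
exists (m2 - u1), u1, (m0 - u1), 0; split; [by split; lia | by split; lia |].
by apply: IHm; lia.
Qed.

(* The replacements reduce to b = 0 and a_0 + a_1 = m m_2: if no excess can be
   removed, all the conditions involved are tight, against m_0 + m_1 <= m_2. *)
Lemma splits_large m0 m1 m2 m a0 a1 a2 b : m0 + m1 <= m2 ->
  fat_cond (m * m0) (m * m1) (m * m2) a0 a1 a2 b ->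
  splits m0 m1 m2 m a0 a1 a2 b.
Proof.
move=> le_m; have le_mm : m * m0 + m * m1 <= m * m2.
  by rewrite -mulnDr leq_mul2l le_m orbT.
(* Counting b twice makes the measure drop when a remaining variable is traded for x_0 or x_1. *)
have [n] := ubnP (a0 + a1 + b + b); elim: n a0 a1 a2 b => // n IHn a0 a1 a2 b le_n.
case=> [C0 C1 C2].
have [gt2|le2] := ltnP (m * m2) (a0 + a1 + b).
  case: b => [|b] in le_n C0 C1 C2 gt2 *; last first.
    by apply: splits_replace2; apply: IHn; [lia | split; lia].
  (* Since m m_0 + m m_1 <= m m_2 < a_0 + a_1, either a_0 exceeds m m_1 or a_1 exceeds m m_0, and
     that exponent can drop. *)
  have [gt1|le1] := ltnP (m * m1) a0.
    apply: (@splits_mono _ _ _ _ a0.-1 a1 a2 0) => //; first by lia.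
    by apply: IHn; [lia | split; lia].
  apply: (@splits_mono _ _ _ _ a0 a1.-1 a2 0) => //; first by lia.
  by apply: IHn; [lia | split; lia].
case: b => [|b] in le_n C0 C1 C2 le2 *; last first.
  have [gt0|le0] := ltnP (m * m0) (a1 + a2 + b.+1).
    by apply: splits_replace0; apply: IHn; [lia | split; lia].
  (* Tightness at P_0 and P_2 gives m m_1 <= a_0 - a_2, so the condition at P_1 survives the
     trade. *)
  by apply: splits_replace1; apply: IHn; [lia | split; lia].
(* Now a_2 is cut to what the conditions at P_0 and P_1 require; at most one of them requires
   anything. *)
have [le0|gt0] := leqP (m * m0) a1; last first.
  apply: (@splits_mono _ _ _ _ a0 a1 (m * m0 - a1) 0) => //; first by lia.
  by apply: splits_large_corner => //; lia.
have [le1|gt1] := leqP (m * m1) a0; last first.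
  apply: (@splits_mono _ _ _ _ a0 a1 (m * m1 - a0) 0) => //; first by lia.
  by apply: splits_swap01; apply: splits_large_corner => //; lia.
apply: (@splits_mono _ _ _ _ a0 a1 0 0) => //.
by apply: splits_large_edge => //; lia.
Qed.

(** The shortage of a_0 below m k_0 is made up by a_1 and a_2: a factor (k_0 - t, k_1 + t, k_2 + t)
    stays tight at P_1 and P_2, and t absorbs as much of the shortage as fits. *)
Lemma splits_even_axis k0 k1 k2 m a0 a1 a2 :
  a0 <= m * k0 -> m * (k0 + k1) <= a0 + a1 -> m * (k0 + k2) <= a0 + a2 ->
  splits (k1 + k2) (k0 + k2) (k0 + k1) m a0 a1 a2 0.
Proof.
elim: m a0 a1 a2 => //= m IHm a0 a1 a2; rewrite !mulSn !mulnDr => e l1 l2.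
pose t := minn k0 (m.+1 * k0 - a0).
exists (k0 - t), (k1 + t), (k2 + t), 0; split; [by split; lia | by split; lia |].
by apply: IHm; rewrite ?mulnDr; lia.
Qed.

(** Trading x_0^t x_1^t x_2^t for degree 2t in the remaining variables preserves all three
    conditions; [d] trades are distributed, at most [k] per factor. *)
Lemma splits_even_center k k0 k1 k2 m d a0 a1 a2 :
  k <= k0 -> k <= k1 -> k <= k2 -> d <= m * k ->
  m * k0 <= d + a0 -> m * k1 <= d + a1 -> m * k2 <= d + a2 ->
  splits (k1 + k2) (k0 + k2) (k0 + k1) m a0 a1 a2 d.*2.
Proof.
move=> l0 l1 l2; elim: m d a0 a1 a2 => //= m IHm d a0 a1 a2.
rewrite !mulSn => ld e0 e1 e2.
have mono k' : k <= k' -> m * k <= m * k' by rewrite leq_mul2l => ->; rewrite orbT.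
have [l0m l1m l2m] := And3 (mono _ l0) (mono _ l1) (mono _ l2).
pose t := minn d k.
exists (k0 - t), (k1 - t), (k2 - t), t.*2; split; [by split; lia | by split; lia |].
have -> : d.*2 - t.*2 = (d - t).*2 by lia.
by apply: IHm; lia.
Qed.

(* The numbers k_i solve m_i = k_j + k_l.  If b > 0 and no variable can be
   replaced, the three conditions are tight, so that b = 2d and
   a_i = m k_i - d for all i; if b = 0, at most one a_i is below m k_i. *)
Lemma splits_even k0 k1 k2 m a0 a1 a2 b :
  fat_cond (m * (k1 + k2)) (m * (k0 + k2)) (m * (k0 + k1)) a0 a1 a2 b ->
  splits (k1 + k2) (k0 + k2) (k0 + k1) m a0 a1 a2 b.
Proof.
elim: b a0 a1 a2 => [|b IHb] a0 a1 a2 [C0 C1 C2].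
  have [le0|gt0] := leqP a0 (m * k0); first by apply: splits_even_axis; lia.
  have [le1|gt1] := leqP a1 (m * k1).
    apply: splits_swap01; rewrite (addnC k0 k1).
    by apply: splits_even_axis; lia.
  have [le2|gt2] := leqP a2 (m * k2).
    apply: splits_swap12; apply: splits_swap01.
    rewrite (addnC k0 k1) (addnC k0 k2) (addnC k1 k2).
    by rewrite (addnC k1 k0); apply: splits_even_axis; lia.
  (* No exponent falls short, so lowering a_0 to m k_0 gives the axis case with zero shortage. *)
  apply: (@splits_mono _ _ _ _ (m * k0) a1 a2 0); rewrite ?(ltnW gt0) //.
  by apply: splits_even_axis; lia.
have [gt0|le0] := ltnP (m * (k1 + k2)) (a1 + a2 + b.+1).
  by apply: splits_replace0; apply: IHb; split; lia.
have [gt1|le1] := ltnP (m * (k0 + k2)) (a0 + a2 + b.+1).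
  by apply: splits_replace1; apply: IHb; split; lia.
have [gt2|le2] := ltnP (m * (k0 + k1)) (a0 + a1 + b.+1).
  by apply: splits_replace2; apply: IHb; split; lia.
have -> : b.+1 = (b.+1./2).*2 by lia.
(* As a_i = m k_i - d is an exponent, d <= m k_i for every i. *)
apply: (@splits_even_center (minn k0 (minn k1 k2))); lia.
Qed.

Local Open Scope ring_scope.

(** * Ideals and their powers *)

Section IdealTheory.
Variable R : comNzRingType.
Implicit Types (S I J : R -> Prop) (f g : R) (n k : nat).

Definition is_ideal I : Prop :=
  [/\ I 0, forall f g, I f -> I g -> I (f + g) & forall f g, I g -> I (f * g)].

Lemma ideal_gen_sub S I : is_ideal I -> (forall f, S f -> I f) ->
  forall f, ideal_gen S f -> I f.
Proof.
case=> [I0 ID IM] SI f [s Ss ->]; rewrite big_seq.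
by elim/big_ind: _ => // z /Ss /SI; exact: IM.
Qed.

Lemma ideal_gen_mem S f : S f -> ideal_gen S f.
Proof.
move=> Sf; exists [:: (1, f)]; last by rewrite big_seq1 mul1r.
by move=> z; rewrite inE => /eqP ->.
Qed.

Lemma ideal_gen_is_ideal S : is_ideal (ideal_gen S).
Proof.
split=> [|f g [s Ss ->] [t St ->]|f g [s Ss ->]].
- by exists [::]; rewrite ?big_nil.
- exists (s ++ t); last by rewrite big_cat.
  by move=> z; rewrite mem_cat => /orP[/Ss|/St].
exists [seq (f * z.1, z.2) | z <- s]; first by move=> z /mapP[y /Ss ? ->].
by rewrite big_map mulr_sumr; apply: eq_bigr => z _; rewrite mulrA.
Qed.

Lemma ideal_exp_is_ideal I n : is_ideal (ideal_exp I n).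
Proof. by case: n => [|n]; [split | exact: ideal_gen_is_ideal]. Qed.

Lemma is_ideal_sum I (T : eqType) (r : seq T) (F : T -> R) :
  is_ideal I -> (forall x, x \in r -> I (F x)) -> I (\sum_(x <- r) F x).
Proof.
by case=> [I0 ID _] IF; rewrite big_seq; elim/big_ind: _.
Qed.

Lemma ideal_expS I n f g : I f -> ideal_exp I n g -> ideal_exp I n.+1 (f * g).
Proof. by move=> If Ig; apply: ideal_gen_mem; exists f, g. Qed.

Lemma ideal_expD I m n f g : ideal_exp I m f -> ideal_exp I n g ->
  ideal_exp I (m + n) (f * g).
Proof.
move=> + Ig; elim: m f => [|m IHm] f.
  by move=> _; have [_ _] := ideal_exp_is_ideal I n; apply.
have [J0 JD JM] := ideal_exp_is_ideal I (m.+1 + n).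
(* For fixed [g] these f form an ideal, so only generators need checking. *)
pose J f := ideal_exp I (m.+1 + n) (f * g).
apply: (@ideal_gen_sub _ J); rewrite /J.
  split=> [|p q|p q]; rewrite ?mul0r ?mulrDl -?mulrA //; [exact: JD | exact: JM].
move=> _ [p [q [Ip Iq ->]]]; rewrite -mulrA.
by apply: ideal_expS => //; exact: IHm.
Qed.

Lemma ideal_exp_prod I (T : Type) (r : seq T) (P : pred T) (F : T -> R)
    (e : T -> nat) : (forall x, P x -> ideal_exp I (e x) (F x)) ->
  ideal_exp I (\sum_(x <- r | P x) e x) (\prod_(x <- r | P x) F x).
Proof.
move=> IF; elim/big_rec2: _ => // x n p Px; apply: ideal_expD; exact: IF.
Qed.

Lemma ideal_expX I f n : I f -> ideal_exp I n (f ^+ n).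
Proof. by move=> If; elim: n => // n IHn; rewrite exprS; exact: ideal_expS. Qed.

Lemma ideal_exp_le I m n f : (m <= n)%N -> ideal_exp I n f -> ideal_exp I m f.
Proof.
elim: n m f => [|n IHn] [|m] f // le_mn.
apply: ideal_gen_sub; first exact: (ideal_exp_is_ideal I m.+1).
by move=> _ [g [h [Ig Ih ->]]]; apply: ideal_expS => //; exact: IHn.
Qed.

(** Turns a vanishing defect into a containment: the empty family leaves [f] itself in [I], and
    minimality is void at 0. *)
Lemma quot_min_ngen0 I J :
  quot_min_ngen J I 0 <-> (forall f, J f -> I f).
Proof.
split=> [[[e [_ gen]] _] f /gen[c]|JI]; first by rewrite big_ord0 subr0.
split=> //; exists (fun=> 0); split=> [[]//|f /JI If].
by exists (fun=> 0); rewrite big_ord0 subr0.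
Qed.

End IdealTheory.

(** * Monomial ideals cut out by an additive weight *)

Section MonomialWeight.
Variables (K : fieldType) (n : nat) (w : 'X_{1..n} -> nat).
Hypothesis wD : forall a b, w (a + b)%MM = (w a + w b)%N.
Implicit Types (f g : {mpoly K[n]}).

Definition weight_ge k f : Prop := forall a, a \in msupp f -> (k <= w a)%N.

Lemma weight_ge0 k : weight_ge k 0.
Proof. by move=> a; rewrite msupp0. Qed.

Lemma weight_geD k f g : weight_ge k f -> weight_ge k g -> weight_ge k (f + g).
Proof.
by move=> kf kg a /msuppD_le; rewrite mem_cat => /orP[/kf|/kg].
Qed.

Lemma weight_geM j k f g :
  weight_ge j f -> weight_ge k g -> weight_ge (j + k) (f * g).
Proof.
move=> jf kg a /msuppM_le /allpairsP[[b c] [/= /jf lb /kg lc ->]].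
by rewrite wD leq_add.
Qed.

Lemma weight_ge_is_ideal k : is_ideal (weight_ge k).
Proof.
split; [exact: weight_ge0 | exact: weight_geD | move=> f g kg].
by rewrite -[k]add0n; apply: weight_geM.
Qed.

(** Serves both the powers of a point ideal and those of I(Z); [psi] carries the change of
    coordinates. *)
Lemma weight_ge_exp (I : {mpoly K[n]} -> Prop)
    (psi : {rmorphism {mpoly K[n]} -> {mpoly K[n]}}) k :
  (forall f, I f -> weight_ge k (psi f)) ->
  forall m f, ideal_exp I m f -> weight_ge (m * k) (psi f).
Proof.
move=> Ik; elim=> [//|m IHm] f.
have [J0 JD JM] := weight_ge_is_ideal (m.+1 * k).
apply: (@ideal_gen_sub _ _ (fun f => weight_ge (m.+1 * k) (psi f))).
  split=> [|g h|g h]; rewrite ?rmorph0 ?rmorphD ?rmorphM //; [exact: JD | exact: JM].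
move=> _ [g [h [/Ik Ig /IHm Ih ->]]]; rewrite rmorphM mulSn.
exact: weight_geM.
Qed.

End MonomialWeight.

(** * Linear changes of variables *)

Section LinearSubstitution.
Variables (K : fieldType) (n : nat).
Implicit Types (M L : 'M[K]_n) (p : {mpoly K[n]}).

(** The forms are read off the columns, so that substitution matches right multiplication of row
    vectors by [M]. *)
Definition lin_forms M : n.-tuple {mpoly K[n]} :=
  [tuple \sum_k M k j *: 'X_k | j < n].

Lemma meval_lin_forms M (v : 'rV[K]_n) p :
  (p \mPo lin_forms M).@[v 0] = p.@[(v *m M) 0].
Proof.
rewrite comp_mpoly_meval; apply: meval_eq => j.
rewrite tnth_mktuple raddf_sum mxE /=; apply: eq_bigr => k _.
by rewrite mevalZ mevalXU mulrC.
Qed.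

Lemma lin_forms_inv M L p : M *m L = 1%:M ->
  (p \mPo lin_forms L) \mPo lin_forms M = p.
Proof.
move=> ML1; rewrite (comp_mpolyEX p) [RHS]mpolyE raddf_sum /=.
apply: eq_bigr => a _; rewrite comp_mpolyZ; congr (_ *: _).
rewrite comp_mpolyX rmorph_prod /= mpolyXE_id; apply: eq_bigr => j _.
rewrite rmorphXn /=; congr (_ ^+ _); rewrite tnth_mktuple raddf_sum /=.
under eq_bigr => k _ do
  rewrite comp_mpolyZ comp_mpolyXU -tnth_nth tnth_mktuple scaler_sumr.
(* The coefficient of ['X_l] in the image of ['X_j] is the entry (l, j) of [M *m L]. *)
rewrite exchange_big /= (bigD1 j) //= [X in _ + X]big1 ?addr0 => [|l nlj].
  under eq_bigr => k _ do rewrite scalerA mulrC.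
  rewrite -scaler_suml; move/matrixP/(_ j j): ML1; rewrite !mxE eqxx => ->.
  by rewrite scale1r.
under eq_bigr => k _ do rewrite scalerA mulrC.
rewrite -scaler_suml; move/matrixP/(_ l j): ML1; rewrite !mxE (negPf nlj) => ->.
by rewrite scale0r.
Qed.

Lemma dhomog_lin_forms M d p : p \is d.-homog -> p \mPo lin_forms M \is d.-homog.
Proof.
move=> /dhomogP hp; rewrite comp_mpolyEX big_seq; apply: rpred_sum => a /hp <-.
apply: dhomogZ; rewrite comp_mpolyX /= mdegE.
elim/big_rec2: _ => [|j e q _ hq]; first exact: dhomog1.
apply: dhomogM hq; rewrite -[X in X.-homog]mul1n; apply: dhomogMn.
rewrite tnth_mktuple; apply: rpred_sum => k _; apply: dhomogZ.
by rewrite dhomogX /= mdeg1.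
Qed.

End LinearSubstitution.

(** * Powers of the ideal of a point *)

Section PointIdeal.
Variables (K : closedFieldType) (N : nat) (A B : 'M[K]_N.+1).
Hypothesis AB1 : A *m B = 1%:M.
Variables (P : ppoint K N) (i : 'I_N.+1).
Hypothesis Pi : ppoint_space P = <[row i A]>%VS.

(** The order of vanishing of a monomial at the i-th coordinate point. *)
Definition off_degree (a : 'X_{1..N.+1}) : nat := \sum_(j | j != i) a j.

Lemma off_degreeD a b : off_degree (a + b)%MM = (off_degree a + off_degree b)%N.
Proof. by rewrite /off_degree -big_split; apply: eq_bigr => j _; rewrite mnmDE. Qed.

(** Only the pure power of x_i survives at the coordinate point, and homogeneity leaves room for
    just one such monomial. *)
Lemma meval_unit_vector d (g : {mpoly K[N.+1]}) a : g \is d.-homog ->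
  a \in msupp g -> off_degree a = 0%N ->
  g.@[(delta_mx 0 i : 'rV_N.+1) 0] = g@_a.
Proof.
move=> /dhomogP hg ag a0.
have val (m : 'X_{1..N.+1}) : \prod_j ((delta_mx 0 i : 'rV[K]_N.+1) 0 j) ^+ m j
    = (off_degree m == 0)%:R.
  have [m0|] := eqVneq (off_degree m) 0%N.
    apply: big1 => j _; rewrite mxE eqxx; have [->|/= ij] := eqVneq j i.
      by rewrite expr1n.
    move/eqP: m0; rewrite sum_nat_eq0 => /forallP/(_ j)/implyP/(_ ij)/eqP ->.
    by rewrite expr0.
  rewrite sum_nat_eq0 negb_forall => /existsP[j]; rewrite negb_imply => /andP[ij mj].
  rewrite (bigD1 j) //= mxE (negPf ij) andbF expr0n (negPf mj).
  by rewrite mul0r.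
rewrite mevalE (bigD1_seq a) //= ?msupp_uniq // val a0 eqxx mulr1.
rewrite big_seq_cond big1 ?addr0 // => m /andP[mg ma].
rewrite val; case: eqVneq => [m0|]; last by rewrite mulr0.
case/eqP: ma; apply/mnmP.
have off0 (b : 'X_{1..N.+1}) : off_degree b = 0%N -> forall j, j != i -> b j = 0%N.
  move/eqP; rewrite sum_nat_eq0 => /forallP b0 j ij.
  by have /implyP/(_ ij)/eqP := b0 j.
have degi (b : 'X_{1..N.+1}) : off_degree b = 0%N -> mdeg b = b i.
  move=> b0; rewrite mdegE (bigD1 i) //=.
  by rewrite -[X in (_ + X)%N]/(off_degree b) b0 addn0.
move=> j; have [->|ij] := eqVneq j i; last by rewrite !off0.
by rewrite -!degi // (hg m mg) (hg a ag).
Qed.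

Lemma point_ideal_weight f : point_ideal P f ->
  weight_ge off_degree 1 (f \mPo lin_forms A).
Proof.
have [J0 JD JM] := weight_ge_is_ideal K off_degreeD 1.
apply: (@ideal_gen_sub _ _ (fun f => weight_ge off_degree 1 (f \mPo lin_forms A))).
  split=> [|g h|g h]; rewrite ?rmorph0 ?rmorphD ?rmorphM //; [exact: JD | exact: JM].
move=> {}f [[d hf] vf] a ag; rewrite lt0n; apply/eqP => a0.
have := meval_unit_vector (dhomog_lin_forms A hf) ag a0.
rewrite meval_lin_forms -rowE vf ?Pi ?memv_line // => /esym/eqP.
by rewrite mcoeff_eq0 ag.
Qed.

Lemma point_ideal_lin_form j : j != i -> point_ideal P ('X_j \mPo lin_forms B).
Proof.
move=> ji; apply: ideal_gen_mem; split.
  by exists 1%N; apply: dhomog_lin_forms; rewrite dhomogX /= mdeg1.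
move=> v; rewrite Pi => /vlineP[c ->]; rewrite meval_lin_forms mevalXU.
by rewrite -scalemxAl -row_mul AB1 !mxE eq_sym (negPf ji) mulr0.
Qed.

(** For the converse, [f] is expanded in monomials in the forms ['X_j \mPo lin_forms B]; those with
    j != i lie in I(P), and each monomial contains at least k of them. *)
Lemma point_ideal_expP k f : ideal_exp (point_ideal P) k f <->
  weight_ge off_degree k (f \mPo lin_forms A).
Proof.
split=> [If|kf].
  rewrite -[k]muln1.
  exact: (weight_ge_exp off_degreeD (psi := comp_mpoly (lin_forms A))
    point_ideal_weight).
have BA1 := mulmx1C AB1.
rewrite -[f](lin_forms_inv f BA1) comp_mpolyEX.
have [J0 JD JM] := ideal_exp_is_ideal (point_ideal P) k.
apply: is_ideal_sum => // a /kf ka; rewrite -mul_mpolyC; apply: JM.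
apply: ideal_exp_le ka _; rewrite comp_mpolyX (bigD1 i) //=.
have [_ _ M] := ideal_exp_is_ideal (point_ideal P) (off_degree a).
apply: M; apply: ideal_exp_prod => j ij; apply: ideal_expX.
by rewrite (tnth_nth 0) -comp_mpolyXU; apply: point_ideal_lin_form.
Qed.

End PointIdeal.

(** * A basis adapted to three noncollinear points *)

Lemma vspace_extend (K : fieldType) (V : vectType K) (U : {vspace V}) k :
  (\dim U <= k <= \dim {:V})%N -> exists2 L : {vspace V}, \dim L = k & (U <= L)%VS.
Proof.
elim: k => [|k IHk] /andP[lUk lkV]; first by exists U; [lia | exact: subvv].
have [lUk'|lkU] := leqP (\dim U) k; last by exists U; [lia | exact: subvv].
have [|L dL UL] := IHk; first by lia.
have /subvPn[v _ vL] : ~~ ({:V} <= L)%VS.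
  by apply: contraL lkV => /dimvS; lia.
exists (<[v]> + L)%VS; last by rewrite (subv_trans UL) // addvSr.
rewrite dimv_disjoint_sum; last first.
  apply/eqP; rewrite -subv0; apply/subvP => u /memv_capP[/vlineP[c ->] uL].
  have [->|c0] := eqVneq c 0; first by rewrite scale0r mem0v.
  by case/negP: vL; rewrite -[v](scalerK c0) memvZ.
rewrite dim_vline dL; case: eqVneq vL => [->|//]; by rewrite mem0v.
Qed.

Lemma ppoint_line (K : closedFieldType) (N : nat) (P : ppoint K N) :
  exists v, ppoint_space P = <[v]>%VS.
Proof.
exists (vpick P); apply/esym/eqP; rewrite eqEdim -memvE memv_pick ppoint_dim.
by rewrite dim_vline vpick0 -dimv_eq0 ppoint_dim.
Qed.

Lemma noncollinear_basis (K : closedFieldType) (N : nat) (P0 P1 P2 : ppoint K N) :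
  (2 <= N)%N -> ~ collinear P0 P1 P2 ->
  exists A B : 'M[K]_N.+1, A *m B = 1%:M /\
    [/\ ppoint_space P0 = <[row (inord 0) A]>%VS,
        ppoint_space P1 = <[row (inord 1) A]>%VS
      & ppoint_space P2 = <[row (inord 2) A]>%VS].
Proof.
move=> hN ncol.
have [v0 e0] := ppoint_line P0; have [v1 e1] := ppoint_line P1.
have [v2 e2] := ppoint_line P2.
pose s := [:: v0; v1; v2].
have dimV : \dim {: 'rV[K]_N.+1} = N.+1 by rewrite dimvf /dim /= mul1n.
have fs : free s.
  rewrite /free eqn_leq dim_span /= ltnNge; apply/negP => dU.
  (* A dependent triple may span less than a line, so its span is enlarged to dimension exactly
     2. *)
  have [|L dL UL] := @vspace_extend _ _ <<s>>%VS 2; first by rewrite dU dimV; lia.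
  apply: ncol; exists L; split=> //.
  split; rewrite ?e0 ?e1 ?e2; apply: subv_trans UL; rewrite -memvE memv_span //.
  - by rewrite !inE eqxx.
  - by rewrite !inE eqxx orbT.
  by rewrite !inE eqxx !orbT.
pose X := s ++ vbasis (<<s>>^C)%VS.
have bX : basis_of fullv X.
  rewrite -(addv_complf <<s>>%VS); apply: cat_basis; last exact: vbasisP.
    by rewrite directvE /= dimv_disjoint_sum // capv_compl.
  by rewrite /basis_of eqxx.
have sX : size X = N.+1.
  by case/andP: bX => /eqP eX /eqnP; rewrite eX dimV.
pose XT := Tuple (introT eqP sX).
pose A := \matrix_(i < N.+1) XT`_i.
(* The coordinates of the unit vectors in the basis formed by the rows of [A], that is, the inverse
   of [A]. *)
pose B := \matrix_(k < N.+1, j < N.+1) coord XT j (delta_mx 0 k).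
have rowA i : row i A = X`_i by rewrite rowK.
exists A, B; split; last first.
  by rewrite !rowA !inordK //; lia.
apply: mulmx1C; apply/row_matrixP => k; rewrite row_mul row1.
rewrite [RHS](coord_basis (X := XT) bX) ?memvf // mulmx_sum_row.
by apply: eq_bigr => j _; rewrite !mxE rowK.
Qed.

(** * Monomials of the symbolic and ordinary powers of I(Z) *)

Lemma multinom_sub_sum n (P : pred 'I_n) (a : 'X_{1..n}) c :
  (c <= \sum_(j | P j) a j)%N ->
  exists u : 'X_{1..n}, [/\ forall j, (u j <= a j)%N, forall j, ~~ P j -> u j = 0%N
    & \sum_(j | P j) u j = c]%N.
Proof.
elim: c => [_|c IHc lt_c].
  by exists 0%MM; split=> [j|j _|]; rewrite ?mnm0E // big1 // => j _; rewrite mnm0E.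
have [u [ua u0 uc]] := IHc (ltnW lt_c).
have [j /andP[Pj uaj]] : exists j, P j && (u j < a j)%N.
  apply/existsP; apply: contraTT lt_c; rewrite negb_exists => /forallP h.
  rewrite -leqNgt -uc; apply: leq_sum => j Pj.
  by have := h j; rewrite Pj /= -leqNgt.
exists (u + U_(j))%MM; split=> [k|k Pk|].
- by rewrite mnmDE mnm1E; case: eqVneq => [<-|_]; rewrite ?addn1 ?addn0.
- rewrite mnmDE mnm1E u0 //; case: eqVneq => [jk|//].
  by move: Pk; rewrite -jk Pj.
rewrite (eq_bigr (fun k => u k + (j == k))%N) => [|k _]; last by rewrite mnmDE mnm1E.
rewrite big_split /= uc (bigD1 j) //= eqxx big1 ?addn1 // => k /andP[_].
by rewrite eq_sym => /negPf ->.
Qed.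

Section ThreePoints.
Variables (K : closedFieldType) (N : nat) (P0 P1 P2 : ppoint K N).
Variables (A B : 'M[K]_N.+1) (i0 i1 i2 : 'I_N.+1) (m0 m1 m2 : nat).
Hypothesis AB1 : A *m B = 1%:M.
Hypothesis P0E : ppoint_space P0 = <[row i0 A]>%VS.
Hypothesis P1E : ppoint_space P1 = <[row i1 A]>%VS.
Hypothesis P2E : ppoint_space P2 = <[row i2 A]>%VS.
Hypotheses (i01 : i1 != i0) (i02 : i2 != i0) (i12 : i2 != i1).
Let BA1 := mulmx1C AB1.

Local Notation Z := [:: (P0, m0); (P1, m1); (P2, m2)].
Local Notation psi f := (f \mPo lin_forms A).
Local Notation phi f := (f \mPo lin_forms B).

Let outer := [pred j | [&& j != i0, j != i1 & j != i2]].
Definition outer_degree (a : 'X_{1..N.+1}) : nat := \sum_(j | outer j) a j.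

Lemma outer_degreeD a b :
  outer_degree (a + b)%MM = (outer_degree a + outer_degree b)%N.
Proof. by rewrite /outer_degree -big_split; apply: eq_bigr => j _; rewrite mnmDE. Qed.

Lemma off_degreeE (a : 'X_{1..N.+1}) :
  [/\ off_degree i0 a = a i1 + a i2 + outer_degree a,
      off_degree i1 a = a i0 + a i2 + outer_degree a
    & off_degree i2 a = a i0 + a i1 + outer_degree a]%N.
Proof.
have i10 : i0 != i1 by rewrite eq_sym.
have i20 : i0 != i2 by rewrite eq_sym.
have i21 : i1 != i2 by rewrite eq_sym.
split; rewrite /off_degree -addnA.
- rewrite (bigD1 i1) //= (bigD1 i2) /= ?i02 //; do 2 congr (_ + _)%N.
  by apply: eq_bigl => j /=; rewrite -andbA.
- rewrite (bigD1 i0) //= (bigD1 i2) /= ?i12 //; do 2 congr (_ + _)%N.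
  by apply: eq_bigl => j /=; rewrite -andbA andbCA.
rewrite (bigD1 i0) //= (bigD1 i1) /= ?i21 //; do 2 congr (_ + _)%N.
by apply: eq_bigl => j /=; rewrite -andbA andbC -andbA.
Qed.

Definition fat_monomial m (a : 'X_{1..N.+1}) :=
  fat_cond (m * m0) (m * m1) (m * m2) (a i0) (a i1) (a i2) (outer_degree a).

Lemma symbolic_powerP m f : symbolic_power Z m f <->
  (forall a, a \in msupp (psi f) -> fat_monomial m a).
Proof.
rewrite /symbolic_power !big_cons big_nil /=.
split=> [[/(point_ideal_expP AB1 P0E) w0 [/(point_ideal_expP AB1 P1E) w1
    [/(point_ideal_expP AB1 P2E) w2 _]]] a aP|w].
  have [e0 e1 e2] := off_degreeE a.
  by split; rewrite -?e0 -?e1 -?e2; [exact: w0 | exact: w1 | exact: w2].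
split; [|split; [|split=> //]].
- apply/(point_ideal_expP AB1 P0E) => a /w[? ? ?].
  by have [-> _ _] := off_degreeE a.
- apply/(point_ideal_expP AB1 P1E) => a /w[? ? ?].
  by have [_ -> _] := off_degreeE a.
apply/(point_ideal_expP AB1 P2E) => a /w[? ? ?].
by have [_ _ ->] := off_degreeE a.
Qed.

(** I(Z) is its own first symbolic power. *)
Lemma fat_idealP f : fat_ideal Z f <->
  (forall a, a \in msupp (psi f) -> fat_monomial 1 a).
Proof.
rewrite -symbolic_powerP /symbolic_power /fat_ideal !big_cons !big_nil /=.
by rewrite !mul1n.
Qed.

Lemma phiK f : psi (phi f) = f.
Proof. exact: lin_forms_inv. Qed.

Lemma psiK f : phi (psi f) = f.
Proof. exact: lin_forms_inv. Qed.

Lemma fat_ideal_monomial u : fat_monomial 1 u -> fat_ideal Z (phi 'X_[u]).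
Proof.
by move=> Cu; apply/fat_idealP => a; rewrite phiK msuppX inE => /eqP ->.
Qed.

Lemma splits_monomial m (a : 'X_{1..N.+1}) :
  splits m0 m1 m2 m (a i0) (a i1) (a i2) (outer_degree a) ->
  ideal_exp (fat_ideal Z) m (phi 'X_[a]).
Proof.
elim: m a => [|m IHm] a //= [u0 [u1 [u2 [c [C [l0 l1 l2 lc] H]]]]].
(* [splits] records only the total outer degree c of a factor; [v] spreads it over the outer
   variables within [a]. *)
have [v [va v0 vc]] := multinom_sub_sum lc.
have out0 j : outer j ->
    ((j == i0 = false) * (j == i1 = false) * (j == i2 = false))%type.
  by case/and3P=> /negPf -> /negPf -> /negPf ->.
pose u := [multinom if j == i0 then u0 else if j == i1 then u1 else
  if j == i2 then u2 else v j | j < N.+1].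
have ui0 : u i0 = u0 by rewrite mnmE eqxx.
have ui1 : u i1 = u1 by rewrite mnmE (negPf i01) eqxx.
have ui2 : u i2 = u2 by rewrite mnmE (negPf i02) (negPf i12) eqxx.
have uo : outer_degree u = c.
  by rewrite -vc; apply: eq_bigr => j /out0 jo; rewrite mnmE !jo.
have ua : (u <= a)%MM.
  by apply/mnm_lepP => j; rewrite mnmE; do 3?[case: eqP => [->|_] //].
rewrite -(submK ua) addmC mpolyXD rmorphM /=; apply: ideal_expS.
  by apply: fat_ideal_monomial; rewrite /fat_monomial !mul1n ui0 ui1 ui2 uo.
apply: IHm; rewrite !mnmBE ui0 ui1 ui2.
suff -> : outer_degree (a - u)%MM = (outer_degree a - c)%N by [].
by rewrite -[in RHS](submK ua) outer_degreeD uo addnK.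
Qed.

Lemma symbolic_power_sub m :
  (forall a0 a1 a2 b, fat_cond (m * m0) (m * m1) (m * m2) a0 a1 a2 b ->
    splits m0 m1 m2 m a0 a1 a2 b) ->
  forall f, symbolic_power Z m f -> ideal_exp (fat_ideal Z) m f.
Proof.
move=> sp f /symbolic_powerP Cf; rewrite -(psiK f) comp_mpolyEX.
have [J0 JD JM] := ideal_exp_is_ideal (fat_ideal Z) m.
apply: is_ideal_sum => // a /Cf Ca; rewrite -mul_mpolyC; apply: JM.
exact/splits_monomial/sp.
Qed.

Lemma symbolic_square_not_sub : (m0 <= m2)%N -> (m1 <= m2)%N ->
  (m2 < m0 + m1)%N -> odd (m0 + m1 + m2) ->
  ~ (forall f, symbolic_power Z 2 f -> ideal_exp (fat_ideal Z) 2 f).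
Proof.
move=> le0 le1 lt2 odd_s sub.
(* The solution of a_1 + a_2 = 2 m_0, a_0 + a_2 = 2 m_1, a_0 + a_1 = 2 m_2; the hypotheses make the
   truncated subtractions exact. *)
pose a := [multinom if j == i0 then m1 + m2 - m0 else if j == i1 then m0 + m2 - m1
  else if j == i2 then m0 + m1 - m2 else 0 | j < N.+1]%N.
have ai0 : a i0 = (m1 + m2 - m0)%N by rewrite mnmE eqxx.
have ai1 : a i1 = (m0 + m2 - m1)%N by rewrite mnmE (negPf i01) eqxx.
have ai2 : a i2 = (m0 + m1 - m2)%N by rewrite mnmE (negPf i02) (negPf i12) eqxx.
have ao : outer_degree a = 0%N.
  by apply: big1 => j /and3P[/negPf j0 /negPf j1 /negPf j2]; rewrite mnmE j0 j1 j2.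
(* Adding the three conditions counts the outer degree three times, the other exponents twice;
   halving and rounding 3/2 up to 2 gives this weight. *)
pose w (b : 'X_{1..N.+1}) := (b i0 + b i1 + b i2 + (outer_degree b).*2)%N.
have wD b c : w (b + c)%MM = (w b + w c)%N.
  by rewrite /w outer_degreeD !mnmDE; lia.
(* Half the sum of the three conditions bounds w from below; the sum is odd,
   hence the strict inequality. *)
have wI f : fat_ideal Z f -> weight_ge w (m0 + m1 + m2)./2.+1 (psi f).
  by move=> /fat_idealP h b /h[]; rewrite /w; lia.
have wI2 := weight_ge_exp wD (psi := comp_mpoly (lin_forms A)) wI.
have /sub/wI2/(_ a) : symbolic_power Z 2 (phi 'X_[a]).
  apply/symbolic_powerP => b; rewrite phiK msuppX inE => /eqP ->.
  by rewrite /fat_monomial ai0 ai1 ai2 ao; split; lia.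
rewrite /= phiK msuppX inE eqxx => /(_ isT).
by rewrite /w ai0 ai1 ai2 ao; lia.
Qed.

End ThreePoints.

Theorem theorem1p6 (K : closedFieldType) (N : nat) (hN : (2 <= N)%N)
    (P0 P1 P2 : ppoint K N) (hP : ~ collinear P0 P1 P2)
    (m0 m1 m2 : nat) (hm : (maxn m0 m1 <= m2)%N) :
  (forall m : nat, sdefect_is [:: (P0, m0); (P1, m1); (P2, m2)] m 0) <->
  ((m0 + m1 <= m2)%N \/ ((m2 < m0 + m1)%N /\ ~~ odd (m0 + m1 + m2))).
Proof.
have [A [B [AB1 [e0 e1 e2]]]] := noncollinear_basis hN hP.
have ne k l : (k < l <= 2)%N -> inord l != inord k :> 'I_N.+1.
  by move=> klN; rewrite -val_eqE /= !inordK; lia.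
have [n01 n02 n12] := And3 (ne 0 1 isT)%N (ne 0 2 isT)%N (ne 1 2 isT)%N.
split=> [sd0|H m].
  have [|lt2] := leqP (m0 + m1) m2; [by left | right; split=> //].
  apply/negP => odd_s.
  have [le0 le1] : (m0 <= m2)%N /\ (m1 <= m2)%N by lia.
  apply: (symbolic_square_not_sub AB1 e0 e1 e2 n01 n02 n12 le0 le1 lt2 odd_s).
  exact/quot_min_ngen0/sd0.
apply/quot_min_ngen0; apply: (symbolic_power_sub AB1 e0 e1 e2 n01 n02 n12).
move=> a0 a1 a2 b; have [le_m|lt_m] := leqP (m0 + m1) m2; first exact: splits_large.
case: H => [|[_ even_s]]; first by lia.
have [k0 [k1 [k2 [-> -> ->]]]] :
    exists k0 k1 k2, [/\ m0 = k1 + k2, m1 = k0 + k2 & m2 = k0 + k1]%N.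
  (* The even sum makes all three halves exact. *)
  exists (m1 + m2 - m0)./2, (m0 + m2 - m1)./2, (m0 + m1 - m2)./2; split; lia.
exact: splits_even.
Qed.
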